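(* Let $(W,S)$ be a Coxeter system of finite rank $n$ with set of reflections $T$, let $(s_1,\dots,s_n)$ be an ordering of $S$ and let $h=s_1s_2\cdots s_n$. If $(W,(s_1,\dots,s_n))$ is well-stabilized and $(W,T,h)$ is pan-transitive, then the groups $\mathrm{Art}(W,S)$ and $\mathrm{Art}^*(W,T,h)$ are isomorphic.
   Context: A Coxeter system $(W,S)$: $W=\langle S\mid (ss')^{m(s,s')}=1\text{ whenever } m(s,s')\neq\infty\rangle$ where $m$ is symmetric, $m(s,s)=1$ and $m(s,s')\in\{2,3,\dots\}\cup\{\infty\}$ for $s\ne s'$. The set of reflections $T$ is the set of all conjugates in $W$ of elements of $S$. For a group $G$ with generating set $X$ and $a\in G$: $\ell_X(a)$ is the minimal $k$ such that $a=x_1\cdots x_k$ with each $x_i\in X\cup X^{-1}$; $\mathrm{Red}_X(a)$ is the set of such $k$-tuples $(x_1,\dots,x_k)$ with $k=\ell_X(a)$; $a\le_X b$ iff $\ell_X(a)+\ell_X(a^{-1}b)=\ell_X(b)$; $[1,b]_X=\{a\in G: a\le_X b\}$. The braid group $B_k=\langle\sigma_1,\dots,\sigma_{k-1}\mid \sigma_i\sigma_{i+1}\sigma_i=\sigma_{i+1}\sigma_i\sigma_{i+1},\ \sigma_i\sigma_j=\sigma_j\sigma_i\ (|i-j|\ge2)\rangle$ acts on $G^k$ (Hurwitz action) by $\sigma_i\cdot(g_1,\dots,g_k)=(g_1,\dots,g_{i-1},g_ig_{i+1}g_i^{-1},g_i,g_{i+2},\dots,g_k)$, $\sigma_i^{-1}\cdot(g_1,\dots,g_k)=(g_1,\dots,g_{i-1},g_{i+1},g_{i+1}^{-1}g_ig_{i+1},g_{i+2},\dots,g_k)$;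 when $X$ is closed under conjugation this preserves $\mathrm{Red}_X(a)$ for $k=\ell_X(a)$. The (standard) Artin group $\mathrm{Art}(W,S)$ is generated by $\bar s_1,\dots,\bar s_n$ subject to $[\bar s_i|\bar s_j]_{m}=[\bar s_j|\bar s_i]_{m}$ for all $i<j$ with $m=m(s_i,s_j)\neq\infty$, where $[a|b]_m$ denotes the alternating product $aba\cdots$ with $m$ factors. The dual Artin group $\mathrm{Art}^*(W,T,h)$ is generated by symbols $\{t\}$, $t\in T\cap[1,h]_T$, subject to $\{t_1\}\cdots\{t_k\}=\{t_1'\}\cdots\{t_k'\}$ for every $a\in[1,h]_T$ and all $(t_1,\dots,t_k),(t'_1,\dots,t'_k)\in\mathrm{Red}_T(a)$. Let $H\le B_n$ be the stabilizer of $(s_1,\dots,s_n)\in W^n$ and $\bar H\le B_n$ the stabilizer of $(\bar s_1,\dots,\bar s_n)\in\mathrm{Art}(W,S)^n$ under the Hurwitz action. $(W,(s_1,\dots,s_n))$ is called well-stabilized if $H=\bar H$. $(W,T,h)$ is called pan-transitive if for every $a\in[1,h]_T$ the Hurwitz action of $B_{\ell_T(a)}$ on $\mathrm{Red}_T(a)$ is transitive. *)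

(* Defs.v *)
From mathcomp Require Import ssreflect ssrfun ssrbool eqtype ssrnat seq fintype.

Set Implicit Arguments.
Unset Strict Implicit.
Unset Printing Implicit Defensive.

(* a letter (x, false) stands for x, (x, true) for x^-1 *)
Definition word (X : Type) := seq (X * bool).

Definition inv_word {X : Type} (w : word X) : word X :=
  rev (map (fun l => (l.1, ~~ l.2)) w).

Definition gen {X : Type} (x : X) : word X := [:: (x, false)].

(* The congruence on words defining the group < X | a = b for R a b > :
   equality in the presented group. *)
Inductive peq {X : Type} (R : word X -> word X -> Prop) : word X -> word X -> Prop :=
  | peq_refl w : peq R w w
  | peq_sym u v : peq R u v -> peq R v u
  | peq_trans u v w : peq R u v -> peq R v w -> peq R u w
  | peq_free u v x b : peq R (u ++ (x, b) :: (x, ~~ b) :: v) (u ++ v)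
  | peq_rel u v a b : R a b -> peq R (u ++ a ++ v) (u ++ b ++ v).

Definition extw {X Y : Type} (f : X -> word Y) (w : word X) : word Y :=
  flatten (map (fun l => if l.2 then inv_word (f l.1) else f l.1) w).

Definition induces_hom {X Y : Type} (R : word X -> word X -> Prop)
  (R' : word Y -> word Y -> Prop) (f : X -> word Y) : Prop :=
  forall a b, R a b -> peq R' (extw f a) (extw f b).

Definition pres_iso {X Y : Type} (R : word X -> word X -> Prop)
  (R' : word Y -> word Y -> Prop) : Prop :=
  exists (f : X -> word Y) (g : Y -> word X),
    [/\ induces_hom R R' f, induces_hom R' R g,
        (forall x, peq R (extw g (f x)) (gen x)) &
        (forall y, peq R' (extw f (g y)) (gen y))].

Definition tuple_peq {X : Type} (R : word X -> word X -> Prop)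
  (s t : seq (word X)) : Prop :=
  size s = size t /\ forall i, i < size s -> peq R (nth [::] s i) (nth [::] t i).

(* braid letter (i, false) = sigma_i, (i, true) = sigma_i^-1, 1 <= i <= k-1 *)
Definition braid_word (k : nat) (beta : seq (nat * bool)) : Prop :=
  all (fun l => (0 < l.1) && (l.1 < k)) beta.

Definition hurwitz_letter {X : Type} (l : nat * bool) (s : seq (word X))
  : seq (word X) :=
  let j := l.1.-1 in
  match drop j s with
  | a :: b :: rest =>
      if l.2 then take j s ++ [:: b, inv_word b ++ a ++ b & rest]
      else take j s ++ [:: a ++ b ++ inv_word a, a & rest]
  | _ => s
  end.

Definition hurwitz {X : Type} (beta : seq (nat * bool)) (s : seq (word X))
  : seq (word X) := foldr hurwitz_letter s beta.

(* m i j = None encodes m(s_i,s_j) = infinity *)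
Definition coxeter_matrix (n : nat) (m : 'I_n -> 'I_n -> option nat) : Prop :=
  [/\ forall i j, m i j = m j i,
      forall i, m i i = Some 1 &
      forall i j, i != j -> m i j = None \/ exists k, m i j = Some k /\ 2 <= k].

Fixpoint alt {X : Type} (a b : X) (k : nat) : word X :=
  if k is k'.+1 then (a, false) :: alt b a k' else [::].

Definition cox_rel (n : nat) (m : 'I_n -> 'I_n -> option nat)
  (u v : word 'I_n) : Prop :=
  exists i j k, m i j = Some k /\ u = alt i j (2 * k) /\ v = [::].

Definition artin_rel (n : nat) (m : 'I_n -> 'I_n -> option nat)
  (u v : word 'I_n) : Prop :=
  exists (i j : 'I_n) k, i < j /\ m i j = Some k /\ u = alt i j k /\ v = alt j i k.

Section Lengths.
Variables (X : Type) (R : word X -> word X -> Prop) (P : word X -> Prop).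

Definition factorization (a : word X) (ts : seq (word X)) : Prop :=
  (forall i, i < size ts -> P (nth [::] ts i) \/ P (inv_word (nth [::] ts i))) /\ peq R (flatten ts) a.

Definition is_length (a : word X) (k : nat) : Prop :=
  (exists ts, size ts = k /\ factorization a ts) /\
  (forall ts, factorization a ts -> k <= size ts).

Definition reduced (a : word X) (ts : seq (word X)) : Prop :=
  factorization a ts /\ is_length a (size ts).

Definition le_gen (a b : word X) : Prop :=
  exists k1 k2 k3, [/\ is_length a k1, is_length (inv_word a ++ b) k2,
                       is_length b k3 & k1 + k2 = k3].
End Lengths.

Section CoxeterData.
Variables (n : nat) (m : 'I_n -> 'I_n -> option nat) (sigma : 'I_n -> 'I_n).

Definition WR := cox_rel m.
Definition AR := artin_rel m.

Definition is_reflection (t : word 'I_n) : Prop :=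
  exists (w : word 'I_n) (i : 'I_n), peq WR t (w ++ gen i ++ inv_word w).

Definition coxeter_elt : word 'I_n := map (fun k => (sigma k, false)) (enum 'I_n).

(* the tuple (s_1, ..., s_n), as words, read in W or in Art(W,S) *)
Definition simple_tuple : seq (word 'I_n) := map (fun k => gen (sigma k)) (enum 'I_n).

Definition in_interval (a : word 'I_n) : Prop :=
  le_gen WR is_reflection a coxeter_elt.

Definition dual_gen : Type := { t : word 'I_n | is_reflection t /\ in_interval t }.

Definition dual_rel (u v : word dual_gen) : Prop :=
  exists (a : word 'I_n) (ts ts' : seq dual_gen),
    in_interval a /\
    [/\ reduced WR is_reflection a (map (@proj1_sig _ _) ts),
        reduced WR is_reflection a (map (@proj1_sig _ _) ts'),
        size ts = size ts',
        u = map (fun t => (t, false)) ts &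
        v = map (fun t => (t, false)) ts'].

Definition well_stabilized : Prop :=
  forall beta, braid_word n beta ->
    (tuple_peq WR (hurwitz beta simple_tuple) simple_tuple <->
     tuple_peq AR (hurwitz beta simple_tuple) simple_tuple).

Definition pan_transitive : Prop :=
  forall a k, in_interval a -> is_length WR is_reflection a k ->
    forall ts ts', reduced WR is_reflection a ts -> reduced WR is_reflection a ts' ->
      exists beta, braid_word k beta /\ tuple_peq WR (hurwitz beta ts) ts'.
End CoxeterData.

Arguments dual_rel {n} m sigma u v.
Arguments dual_gen {n} m sigma.
Arguments in_interval {n} m sigma a.
Arguments well_stabilized {n} m sigma.
Arguments pan_transitive {n} m sigma.
Arguments AR {n} m u v.
Arguments WR {n} m u v.

(* Main.v *)
(* Since the same words represent a Hurwitz conjugate of (s_1, ..., s_n) in W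
   and in Art(W,S), a dual generator {t} can be lifted to Art(W,S): pan-transitivity
   gives a braid carrying (s_1, ..., s_n) to a factorization of h that starts with t,
   and {t} is sent to the head of the corresponding Hurwitz conjugate in Art(W,S).
   Two such braids differ by a braid on the tail and an element of H = \bar H, so
   the lift is well defined; moving entries to the front shows that it agrees with
   every entry of every Hurwitz conjugate, hence respects the dual relations.
   Conversely s_i is sent to {s_i}: the dual relations {x}{y} = {x y x^-1}{x} run
   around a dihedral Hurwitz orbit give the braid relations.  That (s_1, ..., s_n) is
   T-reduced follows from a representation in which reflections fix a hyperplane
   while h fixes only a subspace of codimension n. *)
From Stdlib Require Import Setoid Morphisms IndefiniteDescription.
Require Import Defs.
From mathcomp Require Import all_boot all_algebra all_field.
From mathcomp Require Import ring.

Set Implicit Arguments.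
Unset Strict Implicit.
Unset Printing Implicit Defensive.

Import GRing.Theory.

(** * Words and Hurwitz moves *)

#[local] Hint Resolve peq_refl : core.

Section PresentedGroup.
Variables (X : Type) (R : word X -> word X -> Prop).
Implicit Types (u v w : word X) (s t p q : seq (word X)).

#[export] Instance peq_equivalence : Equivalence (peq R).
Proof.
split; first exact: peq_refl; first exact: peq_sym.
by move=> u v w; exact: peq_trans.
Qed.

Lemma peq_context u v w w' : peq R u v -> peq R (w ++ u ++ w') (w ++ v ++ w').
Proof.
elim=> {u v} [u|u v _ IH|u v z _ IH1 _ IH2|u v x b|u v a b Rab].
- by [].
- by symmetry.
- by transitivity (w ++ v ++ w').
- by have := peq_free R (w ++ u) (v ++ w') x b; rewrite -!catA.
- by have := peq_rel (w ++ u) (v ++ w') Rab; rewrite -!catA.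
Qed.

#[export] Instance peq_cat : Proper (peq R ==> peq R ==> peq R) cat.
Proof.
move=> u u' Hu v v' Hv; transitivity (u' ++ v).
  exact: (peq_context [::] v Hu).
by have := peq_context u' [::] Hv; rewrite !cats0.
Qed.

Lemma peq_relation u v : R u v -> peq R u v.
Proof. by move/(peq_rel [::] [::]); rewrite !cats0. Qed.

Lemma inv_wordK : involutive (@inv_word X).
Proof.
move=> w; rewrite /inv_word map_rev revK -map_comp -[RHS]map_id.
by apply: eq_map => -[x b] /=; rewrite negbK.
Qed.

Lemma inv_word_cat u v : inv_word (u ++ v) = inv_word v ++ inv_word u.
Proof. by rewrite /inv_word map_cat rev_cat. Qed.

Lemma size_inv_word w : size (inv_word w) = size w.
Proof. by rewrite size_rev size_map. Qed.

Lemma peq_mulV w : peq R (w ++ inv_word w) [::].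
Proof.
elim: w => [|[x b] w IH]; first by [].
rewrite -cat1s inv_word_cat -catA [w ++ _]catA IH /=.
exact: (peq_free R [::] [::] x b).
Qed.

Lemma peq_Vmul w : peq R (inv_word w ++ w) [::].
Proof. by have := peq_mulV (inv_word w); rewrite inv_wordK. Qed.

Lemma peq_mulVK w u : peq R (w ++ inv_word w ++ u) u.
Proof. by rewrite catA peq_mulV. Qed.

Lemma peq_VmulK w u : peq R (inv_word w ++ w ++ u) u.
Proof. by rewrite catA peq_Vmul. Qed.

Lemma peq_catI w u v : peq R (w ++ u) (w ++ v) -> peq R u v.
Proof. by move=> E; rewrite -(peq_VmulK w u) E peq_VmulK. Qed.

Lemma peq_catIr w u v : peq R (u ++ w) (v ++ w) -> peq R u v.
Proof.
by move=> E; rewrite -[u]cats0 -(peq_mulV w) catA E -catA peq_mulV cats0.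
Qed.

#[export] Instance peq_inv : Proper (peq R ==> peq R) inv_word.
Proof.
by move=> u v E; apply: (@peq_catI v); rewrite peq_mulV -{1}E peq_mulV.
Qed.

Lemma tuple_peq_cons u v s t :
  tuple_peq R (u :: s) (v :: t) <-> peq R u v /\ tuple_peq R s t.
Proof.
split=> [[[sz] E]|[uv [sz E]]].
  by split; [apply: (E 0) | split=> // i i_s; apply: (E i.+1)].
by split=> [|[|i]] //=; [rewrite sz | apply: E].
Qed.

Lemma tuple_peq_cat p q s t : size p = size q ->
  tuple_peq R (p ++ s) (q ++ t) <-> tuple_peq R p q /\ tuple_peq R s t.
Proof.
elim: p q => [|u p IH] [|v q] //= => [_|[/IH E]].
  by split=> [|[]].
by rewrite !tuple_peq_cons E; tauto.
Qed.

#[export] Instance tuple_peq_equivalence : Equivalence (tuple_peq R).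
Proof.
split=> [s|s t [sz E]|s t r [sz E] [sz' E']]; first by split.
  by split=> // i i_t; symmetry; apply: E; rewrite sz.
split=> [|i i_s]; first by rewrite sz.
by rewrite E // E' // -sz.
Qed.

#[export] Instance tuple_peq_flatten :
  Proper (tuple_peq R ==> peq R) flatten.
Proof.
move=> s t; elim: s t => [|u s IH] [|v t] //=; try by case.
by move=> /tuple_peq_cons[-> /IH ->].
Qed.

Lemma flatten_conj w s :
  peq R (flatten [seq inv_word w ++ u ++ w | u <- s])
        (inv_word w ++ flatten s ++ w).
Proof.
elim: s => [|u s IH] /=; first by rewrite peq_Vmul.
by rewrite IH -!catA peq_mulVK.
Qed.

End PresentedGroup.

Section Extension.
Variables (X Y : Type) (f : X -> word Y).

Lemma extw_cat u v : extw f (u ++ v) = extw f u ++ extw f v.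
Proof. by rewrite /extw map_cat flatten_cat. Qed.

Lemma extw_gen x : extw f (gen x) = f x.
Proof. by rewrite /extw /= cats0. Qed.

Lemma extw_inv w : extw f (inv_word w) = inv_word (extw f w).
Proof.
elim: w => [|[x b] w IH] //.
rewrite -cat1s inv_word_cat !extw_cat IH inv_word_cat; congr (_ ++ _).
by rewrite /extw /= !cats0; case: b => //=; rewrite inv_wordK.
Qed.

Lemma extw_positive (s : seq X) :
  extw f [seq (x, false) | x <- s] = flatten (map f s).
Proof. by rewrite /extw -map_comp. Qed.

End Extension.

(** * The Hurwitz action on tuples of words *)

Section Hurwitz.
Variable X : Type.
Implicit Types (x y : word X) (s t p q : seq (word X)) (beta : seq (nat * bool)).

Definition hurwitz_pair (b : bool) x y : seq (word X) :=
  if b then [:: y; inv_word y ++ x ++ y] else [:: x ++ y ++ inv_word x; x].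

Lemma hurwitz_letter_cat b p x y q :
  hurwitz_letter ((size p).+1, b) (p ++ x :: y :: q) =
  p ++ hurwitz_pair b x y ++ q.
Proof.
by rewrite /hurwitz_letter /= drop_size_cat // take_size_cat //; case: b.
Qed.

Lemma split_pair i s : i.+1 < size s ->
  exists p x y q, s = p ++ x :: y :: q /\ size p = i.
Proof.
move=> lt_i; exists (take i s), (nth [::] s i), (nth [::] s i.+1), (drop i.+2 s).
rewrite -!drop_nth ?cat_take_drop ?size_takel //; last exact: ltnW.
  exact/ltnW/ltnW.
Qed.

Lemma size_hurwitz_letter l s : size (hurwitz_letter l s) = size s.
Proof.
rewrite /hurwitz_letter -[in RHS](cat_take_drop l.1.-1 s) size_cat.
case E: (drop _ _) => [|x [|y q]].
- by rewrite -size_cat -E cat_take_drop.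
- by rewrite -size_cat -E cat_take_drop.
- by case: l.2; rewrite size_cat.
Qed.

Lemma size_hurwitz beta s : size (hurwitz beta s) = size s.
Proof. by elim: beta => //= l beta IH; rewrite size_hurwitz_letter. Qed.

Lemma hurwitz_cat beta gamma s :
  hurwitz (beta ++ gamma) s = hurwitz beta (hurwitz gamma s).
Proof. exact: foldr_cat. Qed.

Lemma braid_word_cat k beta gamma :
  braid_word k beta -> braid_word k gamma -> braid_word k (beta ++ gamma).
Proof. by rewrite /braid_word all_cat => -> ->. Qed.

Lemma braid_word_widen k k' beta :
  k <= k' -> braid_word k beta -> braid_word k' beta.
Proof.
move=> le_k; apply: sub_all => l /andP[-> /= lt_l].
exact: leq_trans lt_l le_k.
Qed.

Lemma braid_word_inv k beta : braid_word k beta -> braid_word k (inv_word beta).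
Proof. by rewrite /braid_word all_rev all_map. Qed.

(** The bounds in [braid_word] ensure that each letter meets two adjacent entries, so the fallback
    branch of [hurwitz_letter] never arises. [P] sees the braid as well as the tuple, which lets two
    actions be compared letter by letter. *)
Lemma hurwitz_ind (P : seq (nat * bool) -> seq (word X) -> Prop) s :
  P [::] s ->
  (forall beta b p x y q, braid_word (size s) beta ->
     hurwitz beta s = p ++ x :: y :: q -> P beta (p ++ x :: y :: q) ->
     P (((size p).+1, b) :: beta) (p ++ hurwitz_pair b x y ++ q)) ->
  forall beta, braid_word (size s) beta -> P beta (hurwitz beta s).
Proof.
move=> P0 PS; elim=> [//|[[|i] b] beta IH] //= /andP[/= lt_i beta_s].
have [|p [x [y [q [E szp]]]]] := @split_pair i (hurwitz beta s).
  by rewrite size_hurwitz.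
by rewrite E -szp hurwitz_letter_cat; apply: PS => //; rewrite -E; apply: IH.
Qed.

Lemma hurwitz_catl beta s t :
  braid_word (size s) beta -> hurwitz beta (s ++ t) = hurwitz beta s ++ t.
Proof.
move: beta; apply: (hurwitz_ind
  (P := fun beta s' => hurwitz beta (s ++ t) = s' ++ t)) => //.
move=> beta b p x y q _ _ /= ->.
by rewrite -catA !cat_cons hurwitz_letter_cat -!catA.
Qed.

Lemma hurwitz_cons x beta s : braid_word (size s) beta ->
  hurwitz [seq (l.1.+1, l.2) | l <- beta] (x :: s) = x :: hurwitz beta s.
Proof.
move: beta; apply: (hurwitz_ind (P := fun beta s' =>
  hurwitz [seq (l.1.+1, l.2) | l <- beta] (x :: s) = x :: s')) => //.
move=> beta b p y z q _ _ /= ->.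
exact: (hurwitz_letter_cat b (x :: p)).
Qed.

(* Moves the entry at position [i] to the front without conjugating it. *)
Definition to_front (i : nat) : seq (nat * bool) :=
  [seq (j.+1, true) | j <- iota 0 i].

Lemma to_front_braid i k : i < k -> braid_word k (to_front i).
Proof.
move=> lt_i; apply/allP => l /mapP[j]; rewrite mem_iota /= add0n => lt_j ->.
exact: leq_ltn_trans lt_j lt_i.
Qed.

Lemma nth_to_front i s : i < size s ->
  nth [::] (hurwitz (to_front i) s) 0 = nth [::] s i.
Proof.
elim: i s => [//|i IH] s lt_i.
(* Letters act from the right, so $\sigma_{i+1}^{-1}$ comes first: it carries the entry at position
   $i+1$, counted from 0, unchanged to position $i$. *)
have -> : to_front i.+1 = to_front i ++ [:: (i.+1, true)].
  by rewrite /to_front -[in LHS]addn1 iotaD map_cat.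
rewrite hurwitz_cat IH ?size_hurwitz; last exact: ltnW.
have [p [x [y [q [-> <-]]]]] := split_pair lt_i.
rewrite /= hurwitz_letter_cat /=.
by rewrite !nth_cat ltnn ltnNge leqnSn subnn subSnn.
Qed.

Variable R : word X -> word X -> Prop.

Lemma flatten_hurwitz beta s : braid_word (size s) beta ->
  peq R (flatten (hurwitz beta s)) (flatten s).
Proof.
move: beta; apply: (hurwitz_ind
  (P := fun _ s' => peq R (flatten s') (flatten s))) => //.
move=> beta b p x y q _ _ <-.
rewrite !flatten_cat; case: b => /=; rewrite -!catA.
  by rewrite peq_mulVK.
by rewrite peq_VmulK.
Qed.

Lemma hurwitz_peq beta s t : braid_word (size s) beta ->
  tuple_peq R s t -> tuple_peq R (hurwitz beta s) (hurwitz beta t).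
Proof.
move=> beta_s st; move: beta beta_s.
apply: (hurwitz_ind
  (P := fun beta s' => tuple_peq R s' (hurwitz beta t))) => //.
move=> beta b p x y q beta_s E /= IH.
have [szE _] := IH; rewrite size_cat /= in szE.
have [|p' [x' [y' [q' [E' szp]]]]] := @split_pair (size p) (hurwitz beta t).
  by rewrite -szE addnS ltnS addnS ltnS leq_addr.
move: IH; rewrite E' -szp hurwitz_letter_cat !tuple_peq_cat ?tuple_peq_cons //.
  by case=> ? [Ex [Ey ?]]; split=> //; split=> //; case: b;
     rewrite !tuple_peq_cons Ex Ey.
by case: b.
Qed.

(** Undoing a move leaves uncancelled subwords, hence an equality modulo [R] only. Free cancellation
    suffices, so the lemma serves both in $W$ and in the Artin group. *)
Lemma hurwitzK beta s : braid_word (size s) beta ->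
  tuple_peq R (hurwitz (inv_word beta) (hurwitz beta s)) s.
Proof.
move: beta; apply: (hurwitz_ind (P := fun beta s' =>
  tuple_peq R (hurwitz (inv_word beta) s') s)) => //.
move=> beta b p x y q beta_s E /= IH.
have sz : size (p ++ hurwitz_pair b x y ++ q) = size s.
  by rewrite -(size_hurwitz beta s) E !size_cat /=; case: b.
rewrite -cat1s inv_word_cat hurwitz_cat.
etransitivity; last exact: IH.
apply: hurwitz_peq.
  by rewrite size_hurwitz sz; apply: braid_word_inv.
rewrite /=; case: b {sz} => /=; rewrite hurwitz_letter_cat /=;
  (rewrite tuple_peq_cat //; split; first by [];
   rewrite !tuple_peq_cons -!catA; split; [|split=> //]).
- by rewrite peq_mulVK peq_mulV cats0.
- by [].
- by rewrite peq_VmulK peq_Vmul cats0.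
Qed.

End Hurwitz.

(** Hurwitz moves use only products and inverses, which [extw] respects as words and not merely
    modulo relations. *)
Lemma map_extw_hurwitz (X Y : Type) (f : X -> word Y) beta s :
  map (extw f) (hurwitz beta s) = hurwitz beta (map (extw f) s).
Proof.
elim: beta => //= l beta <-; rewrite /hurwitz_letter -map_drop.
case: (drop _ _) => [|x [|y q]] //=.
by case: l.2; rewrite map_cat map_take /= !extw_cat extw_inv.
Qed.

(** * Reflection length of the Coxeter element *)

Section Reflections.
Variables (n : nat) (m : 'I_n -> 'I_n -> option nat).
Hypothesis m_diag : forall i, m i i = Some 1%N.

Lemma gen_involutive i : peq (WR m) (gen i ++ gen i) [::].
Proof. by apply: peq_relation; exists i, i, 1; rewrite m_diag. Qed.

Lemma gen_inv i : peq (WR m) (inv_word (gen i)) (gen i).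
Proof. by apply: (@peq_catI _ _ (gen i)); rewrite peq_mulV gen_involutive. Qed.

Lemma is_reflection_inv t : is_reflection m t -> is_reflection m (inv_word t).
Proof.
by case=> w [i E]; exists w, i; rewrite E !inv_word_cat inv_wordK gen_inv catA.
Qed.

Lemma is_reflection_conj w t :
  is_reflection m t -> is_reflection m (w ++ t ++ inv_word w).
Proof.
by case=> v [i E]; exists (w ++ v), i; rewrite E inv_word_cat -!catA.
Qed.

Lemma is_reflection_gen i : is_reflection m (gen i).
Proof. by exists [::], i. Qed.

Lemma is_reflection_peq t t' :
  peq (WR m) t t' -> is_reflection m t -> is_reflection m t'.
Proof. by move=> E [w [i Et]]; exists w, i; rewrite -E. Qed.

Lemma odd_size_peq u v : peq (WR m) u v -> odd (size u) = odd (size v).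
Proof.
elim=> {u v} // [u v w _ -> _ -> //|u v i b|u v a b [i [j [k [_ [-> ->]]]]]].
  by rewrite !size_cat /= !oddD /= negbK.
have size_alt (x y : 'I_n) l : size (alt x y l) = l.
  by elim: l x y => //= l IH x y; rewrite IH.
by rewrite !size_cat size_alt mul2n oddD [odd (_ + size v)]oddD odd_double -oddD.
Qed.

Lemma reflection_neq1 t : is_reflection m t -> ~ peq (WR m) t [::].
Proof.
case=> w [i /odd_size_peq E] /odd_size_peq; rewrite E !size_cat size_inv_word.
by rewrite addnCA addnn oddD odd_double.
Qed.

End Reflections.

(** * A reflection representation and codimensions of fixed spaces *)

Section ReflectionRepresentation.
Local Open Scope ring_scope.
Variables (F : fieldType) (n : nat) (m : 'I_n -> 'I_n -> option nat).
Variable eta : 'I_n -> 'I_n -> F.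
Hypothesis eta_neq0 : forall i j, i != j -> eta i j != 0.
Hypothesis etaV : forall i j, i != j -> eta j i = (eta i j)^-1.
Hypothesis eta_neq1 : forall i j, i != j -> eta i j != 1.
Hypothesis eta_root : forall i j k, i != j -> m i j = Some k -> eta i j ^+ k = 1.
Hypothesis m_diag : forall i, m i i = Some 1%N.

(** A nonsymmetric generalized Cartan matrix: opposite off-diagonal entries multiply to
    $2+\eta+\eta^{-1}$, which is $4\cos^2(\pi/k)$ for $\eta=e^{2\pi i/k}$. Roots of unity thus
    replace cosines. *)
Definition cartan i j : F := if i == j then 2%:R else - (1 + eta i j).

Definition root_vec (i : 'I_n) : 'rV[F]_(n + n) := row_mx (delta_mx 0 i) 0.

(* The identity block makes the coroots independent even when [cartan] is singular. *)
Definition coroots : 'M[F]_(n + n, n) := col_mx (\matrix_(i, j) cartan i j) 1%:M.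

Definition pairing (x : 'rV[F]_(n + n)) i : F := (x *m coroots) 0 i.

Definition refl_mx i : 'M[F]_(n + n) := 1%:M - col i coroots *m root_vec i.

Lemma mul_refl_mx x i : x *m refl_mx i = x - pairing x i *: root_vec i.
Proof.
rewrite mulmxBr mulmx1 colE !mulmxA -colE; congr (_ - _).
by rewrite [col _ _]mx11_scalar mul_scalar_mx mxE.
Qed.

Lemma pairing_root i j : pairing (root_vec i) j = cartan i j.
Proof.
by rewrite /pairing /root_vec /coroots mul_row_col mul0mx addr0 -rowE !mxE.
Qed.

Lemma pairingB x y i : pairing (x - y) i = pairing x i - pairing y i.
Proof. by rewrite /pairing mulmxBl !mxE. Qed.

Lemma pairingD x y i : pairing (x + y) i = pairing x i + pairing y i.
Proof. by rewrite /pairing mulmxDl !mxE. Qed.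

Lemma pairingZ a x i : pairing (a *: x) i = a * pairing x i.
Proof. by rewrite /pairing -scalemxAl !mxE. Qed.

Definition pairingE := (pairingB, pairingD, pairingZ, pairing_root).

Lemma refl_mxK i : refl_mx i *m refl_mx i = 1%:M.
Proof.
apply/row_matrixP => k; rewrite !rowE mulmx1 mulmxA !mul_refl_mx !pairingE.
rewrite /cartan eqxx -addrA -opprD -scalerDl; set a := pairing _ _.
have -> : a + (a - a * 2%:R) = 0 by ring.
by rewrite scale0r subr0.
Qed.

Lemma mul_refl2_mx x i j : x *m (refl_mx i *m refl_mx j) =
  x - pairing x i *: root_vec i -
  (pairing x j - pairing x i * cartan i j) *: root_vec j.
Proof. by rewrite mulmxA !mul_refl_mx !pairingE. Qed.

Fixpoint pow_mx (A : 'M[F]_(n + n)) k := if k is k'.+1 then A *m pow_mx A k' else 1%:M.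

Lemma pow_mx_eigen A (x : 'rV_(n + n)) a k :
  x *m A = a *: x -> x *m pow_mx A k = a ^+ k *: x.
Proof.
move=> Ax; elim: k => [|k IH] /=; first by rewrite mulmx1 scale1r.
by rewrite mulmxA Ax -scalemxAl IH scalerA exprS.
Qed.

(* [refl_mx i *m refl_mx j] has eigenvalues [eta i j], its inverse, and 1 on a
   complement of the plane spanned by the two roots. *)
Lemma refl_mx_order i j k : i != j -> m i j = Some k ->
  pow_mx (refl_mx i *m refl_mx j) k = 1%:M.
Proof.
move=> ij mij; have ji : j != i by rewrite eq_sym.
set e := eta i j; have e0 : e != 0 := eta_neq0 ij.
have e1 : e - 1 != 0 by rewrite subr_eq0 eta_neq1.
have ek : e ^+ k = 1 by apply: eta_root.
have cij : cartan i j = - (1 + e) by rewrite /cartan (negbTE ij).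
have cji : cartan j i = - (1 + e^-1) by rewrite /cartan (negbTE ji) etaV.
have cii l : cartan l l = 2%:R by rewrite /cartan eqxx.
set A := _ *m _.
pose v := root_vec i + e *: root_vec j.
pose w := root_vec i + root_vec j.
have vA : v *m A = e *: v.
  rewrite mul_refl2_mx /v !pairingE !cii cij cji.
  move: (root_vec i) (root_vec j) => p q.
  by apply/rowP => l; rewrite !mxE; field.
have wA : w *m A = e^-1 *: w.
  rewrite mul_refl2_mx /w !pairingE !cii cij cji.
  move: (root_vec i) (root_vec j) => p q.
  by apply/rowP => l; rewrite !mxE; field.
apply/row_matrixP => l; rewrite !rowE mulmx1; set x := delta_mx _ _.
(* The coefficients solve the two linear equations [pairing y i = 0] and [pairing y j = 0], using
   $e\ne 0,1$; both reflections then fix [y]. *)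
pose b := - (pairing x i + pairing x j) * e / (e - 1) ^+ 2.
pose a := b + pairing x j / (e - 1).
pose y := x - b *: w - a *: v.
have yi : pairing y i = 0.
  by rewrite /y /v /w !pairingE !(cii, cij, cji) /a /b; field; rewrite e0 e1.
have yj : pairing y j = 0.
  by rewrite /y /v /w !pairingE !(cii, cij, cji) /a /b; field; exact: e1.
have yA : y *m A = 1 *: y.
  by rewrite mul_refl2_mx yi yj mul0r subr0 !scale0r !subr0 scale1r.
have -> : x = y + a *: v + b *: w by rewrite /y !subrK.
clear yi yj; clearbody y v w.
rewrite !mulmxDl -!scalemxAl (pow_mx_eigen _ yA) (pow_mx_eigen _ vA).
by rewrite (pow_mx_eigen _ wA) exprVn ek invr1 expr1n !scale1r.
Qed.

Fixpoint word_mx (w : word 'I_n) : 'M[F]_(n + n) :=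
  if w is l :: w' then refl_mx l.1 *m word_mx w' else 1%:M.

Lemma word_mx_cat u v : word_mx (u ++ v) = word_mx u *m word_mx v.
Proof. by elim: u => [|l u IH] /=; rewrite ?mul1mx // IH mulmxA. Qed.

Lemma word_mx_alt i j k :
  word_mx (alt i j (2 * k)) = pow_mx (refl_mx i *m refl_mx j) k.
Proof. by elim: k => [|k IH] //; rewrite mulnS /= IH mulmxA. Qed.

Lemma word_mx_peq u v : peq (WR m) u v -> word_mx u = word_mx v.
Proof.
elim=> {u v} // [u v w _ -> _ -> //|u v i b|u v a b [i [j [k [mij [-> ->]]]]]].
  by rewrite !word_mx_cat /= [X in _ *m X = _]mulmxA refl_mxK mul1mx.
rewrite !word_mx_cat word_mx_alt mul1mx; congr (_ *m _).
have [ij|/refl_mx_order->//] := eqVneq i j; last by rewrite mul1mx.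
move: mij; rewrite -ij m_diag => -[<-].
by rewrite /= mulmx1 refl_mxK mul1mx.
Qed.

Definition codim_fix (A : 'M[F]_(n + n)) := \rank (1%:M - A).

Lemma codim_fixM A B : (codim_fix (A *m B) <= codim_fix A + codim_fix B)%N.
Proof.
rewrite /codim_fix.
have -> : 1%:M - A *m B = (1%:M - A) + A *m (1%:M - B).
  by rewrite mulmxBr mulmx1 addrA subrK.
by rewrite (leq_trans (mxrank_add _ _)) // leq_add2l mxrankM_maxr.
Qed.

(** Since $1-wsw^{-1}=w(1-s)w^{-1}$, its rank is at most that of $1-s$, which is a column times a
    row. *)
Lemma codim_fix_reflection t : is_reflection m t -> (codim_fix (word_mx t) <= 1)%N.
Proof.
case=> w [i /word_mx_peq ->]; rewrite !word_mx_cat /= mulmx1 /codim_fix.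
have VK : word_mx w *m word_mx (inv_word w) = 1%:M.
  by rewrite -word_mx_cat (word_mx_peq (peq_mulV _ _)).
rewrite -VK -[X in X *m word_mx _]mulmx1 -mulmxA -mulmxBr -mulmxBl.
rewrite (leq_trans (mxrankM_maxr _ _)) // (leq_trans (mxrankM_maxl _ _)) //.
rewrite subKr (leq_trans (mxrankM_maxr _ _)) //; exact: rank_leq_row.
Qed.

(** The easy inequality of Carter's lemma: the codimension is subadditive and at most one on each
    reflection. *)
Lemma codim_fix_le_size a ts :
  factorization (WR m) (is_reflection m) a ts ->
  (codim_fix (word_mx a) <= size ts)%N.
Proof.
case=> Tts /word_mx_peq <-; elim: ts Tts => [|t ts IH] Tts /=.
  by rewrite /codim_fix subrr mxrank0.
rewrite word_mx_cat (leq_trans (codim_fixM _ _)) // -add1n leq_add //.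
  by apply: codim_fix_reflection; case: (Tts 0%N isT) => // /is_reflection_inv;
     rewrite inv_wordK; apply.
by apply: IH => i i_ts; apply: (Tts i.+1).
Qed.

Definition simple_word (s : seq 'I_n) : word 'I_n := [seq (i, false) | i <- s].

(** Each reflection moves a vector by a multiple of its own root, and [lsubmx] reads off the root
    coordinates. *)
Lemma simple_word_coord (x : 'rV_(n + n)) i s : i \notin s ->
  lsubmx (x *m word_mx (simple_word s)) 0 i = lsubmx x 0 i.
Proof.
elim: s x => [|j s IH] x /=; first by rewrite mulmx1.
rewrite inE negb_or => /andP[ij i_s].
rewrite mulmxA IH // mul_refl_mx linearB linearZ /= row_mxKl !mxE /=.
by rewrite (negbTE ij) mulr0 subr0.
Qed.

(** The first letter [j] does not recur, so no later reflection can restore coordinate [j]: the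
    multiple of root [j] subtracted at the start must vanish. Then the first reflection fixes [x]
    and induction applies. *)
Lemma fix_simple_word (x : 'rV_(n + n)) s : uniq s ->
  x *m word_mx (simple_word s) = x -> {in s, forall i, pairing x i = 0}.
Proof.
elim: s => [|j s IH] //= /andP[js uniq_s]; rewrite mulmxA mul_refl_mx => fix_x.
have xj : pairing x j = 0.
  have := simple_word_coord (x - pairing x j *: root_vec j) js.
  rewrite fix_x linearB linearZ /= row_mxKl !mxE !eqxx mulr1.
  by move/eqP; rewrite -subr_eq0 subKr => /eqP.
move: fix_x; rewrite xj scale0r subr0 => /(IH uniq_s) xs i.
by rewrite inE => /predU1P[->|/xs].
Qed.

Lemma codim_fix_simple s : uniq s -> (forall i, i \in s) ->
  (n <= codim_fix (word_mx (simple_word s)))%N.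
Proof.
move=> uniq_s all_s; rewrite /codim_fix; set A := word_mx _.
have rank_coroots : \rank coroots = n.
  apply/eqP; rewrite eqn_leq rank_leq_col /=.
  rewrite -[X in (X <= _)%N](mxrank1 F n).
  have -> : 1%:M = row_mx 0 1%:M *m coroots.
    by rewrite mul_row_col mul0mx add0r mul1mx.
  exact: mxrankM_maxr.
(* Kernels are left kernels: a row vector fixed by [A] pairs to zero with all $n$ independent
   coroots. *)
have : (kermx (1%:M - A) <= kermx coroots)%MS.
  apply/rV_subP => x /sub_kermxP; rewrite mulmxBr mulmx1 => /eqP.
  rewrite subr_eq0 eq_sym => /eqP fix_x; apply/sub_kermxP/rowP => i.
  by rewrite [RHS]mxE; apply: fix_simple_word fix_x _ _.
move/mxrankS; rewrite !mxrank_ker rank_coroots addnK.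
by rewrite leq_subLR addnC -leq_subLR addnK.
Qed.

End ReflectionRepresentation.

Definition root_of_unity (k : nat) : algC :=
  if insub k : {? l | 0 < l} is Some l then sval (C_prim_root_exists (valP l)) else 1%R.

Lemma root_of_unity_prim k : 0 < k -> (k.-primitive_root (root_of_unity k))%R.
Proof.
move=> k0; rewrite /root_of_unity insubT.
exact: (svalP (C_prim_root_exists (valP (exist _ k k0)))).
Qed.

Lemma coxeter_elt_length n (m : 'I_n -> 'I_n -> option nat) (sigma : 'I_n -> 'I_n) ts :
  coxeter_matrix m -> bijective sigma ->
  factorization (WR m) (is_reflection m) (coxeter_elt sigma) ts -> n <= size ts.
Proof.
move=> [mC m1 m2] [tau sigmaK tauK].
(* A pair with $m=\infty$ carries no relation, so the order 2 there is an arbitrary choice above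
   1. *)
pose order i j := if m i j is Some k then k else 2.
pose z i j := root_of_unity (order i j).
(* Comparing indices orients each pair, so that the two values of [eta] on it are inverse to each
   other. *)
pose eta (i j : 'I_n) := if i < j then z i j else (z i j)^-1%R.
have z_prim i j : i != j -> ((order i j).-primitive_root (z i j))%R /\ 1 < order i j.
  move=> ij; have k1 : 1 < order i j.
    by rewrite /order; case: (m2 _ _ ij) => [->|[k [-> ?]]].
  by split=> //; apply/root_of_unity_prim/ltnW.
have zC i j : z i j = z j i by rewrite /z /order mC.
have z0 i j : i != j -> (z i j != 0)%R.
  case/z_prim => /prim_expr_order zk k1; apply/eqP => z0.
  move: zk; rewrite z0 expr0n; case: (order i j) k1 => // k _ /eqP.
  by rewrite eq_sym oner_eq0.
have z1 i j : i != j -> (z i j != 1)%R.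
  by case/z_prim => zk k1; rewrite -(prim_order_dvd zk 1) dvdn1 gtn_eqF.
move=> Fts; apply: leq_trans (@codim_fix_le_size algC n m eta _ _ _ _ m1 _ _ Fts).
- have -> : coxeter_elt sigma = simple_word (map sigma (enum 'I_n)).
    by rewrite /simple_word -map_comp.
  apply: codim_fix_simple => [|i].
    by rewrite map_inj_uniq ?enum_uniq //; apply: can_inj sigmaK.
  by apply/mapP; exists (tau i); rewrite ?mem_enum.
- by move=> i j ij; rewrite /eta; case: ifP; rewrite ?invr_eq0 z0.
- move=> i j ij; rewrite /eta zC; case: (ltngtP i j) => // [_|/val_inj E].
    by rewrite invrK.
  by rewrite E eqxx in ij.
- by move=> i j ij; rewrite /eta; case: ifP; rewrite ?invr_eq1 z1.
- move=> i j k ij mij; have [/prim_expr_order] := z_prim i j ij.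
  rewrite /eta /order mij => zk _.
  by case: ifP; rewrite ?exprVn zk ?invr1.
Qed.

(** * Braid relations and Hurwitz powers *)

Section AlternatingWords.
Variables (X : Type) (R : word X -> word X -> Prop).

Fixpoint alt_prod (a b : word X) k : word X :=
  if k is k'.+1 then a ++ alt_prod b a k' else [::].

Lemma alt_prod_gen i j k : alt_prod (gen i) (gen j) k = alt i j k.
Proof. by elim: k i j => //= k IH i j; rewrite IH. Qed.

(** The third clause identifies [x] as $[a|b]_{k+1}[a|b]_k^{-1}$. It is inductive because $xy=ab$
    turns $xyx^{-1}[a|b]_{k+1}$ into $ab[a|b]_k$. *)
Lemma hurwitz_power a b k : exists x y,
  [/\ hurwitz (nseq k (1, false)) [:: a; b] = [:: x; y],
      peq R (x ++ y) (a ++ b) &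
      peq R (x ++ alt_prod a b k) (alt_prod a b k.+1)].
Proof.
elim: k => [|k [x [y [E xy IH]]]]; first by exists a, b.
exists (x ++ y ++ inv_word x), x; split; first by rewrite /= E.
  by rewrite -!catA peq_Vmul cats0.
by rewrite -IH -!catA peq_VmulK catA xy -catA.
Qed.

(** The second entry after $k$ moves is the first entry after $k-1$ moves, a known quotient of
    alternating products. As [R] is arbitrary, the equivalence can be read forwards in $W$ and
    backwards in the dual group. *)
Lemma hurwitz_power_braid a b k : 0 < k ->
  peq R (nth [::] (hurwitz (nseq k (1, false)) [:: a; b]) 1) b <->
  peq R (alt_prod a b k) (alt_prod b a k).
Proof.
case: k => // k _; have [x [y [E _ xk]]] := hurwitz_power a b k.
rewrite [hurwitz _ _]/= -/(hurwitz _ _) E -xk /=.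
by split=> [-> //|]; apply: peq_catIr.
Qed.

Lemma alt_add (i j : X) k l :
  alt i j (k + l) = alt i j k ++ (if odd k then alt j i l else alt i j l).
Proof.
by elim: k i j => //= k IH i j; rewrite IH; case: odd.
Qed.

End AlternatingWords.

Lemma extw_alt X Y (f : X -> word Y) i j k :
  extw f (alt i j k) = alt_prod (f i) (f j) k.
Proof. by elim: k i j => //= k IH i j; rewrite -IH. Qed.

Lemma coxeter_braid n (m : 'I_n -> 'I_n -> option nat) i j k :
  coxeter_matrix m -> m i j = Some k -> peq (WR m) (alt i j k) (alt j i k).
Proof.
(* [tail l] is [alt j i l] reversed, hence its inverse because generators are involutions; it also
   continues [alt i j l] to the alternating word of length $2l$. *)
case=> _ m1 _ mij; pose tail l := if odd l then alt j i l else alt i j l.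
have cancel l : peq (WR m) (alt j i l ++ tail l) [::].
  elim: l => // l IH; rewrite -[in alt j i l.+1]addn1 alt_add.
  have -> : tail l.+1 = (if odd l then gen i else gen j) ++ tail l.
    by rewrite /tail /=; case: (odd l).
  rewrite -catA [_ ++ (_ ++ tail l)]catA.
  by case: (odd l); rewrite gen_involutive.
apply: (@peq_catIr _ _ (tail k)); rewrite cancel -alt_add addnn -mul2n.
by apply: peq_relation; exists i, j, k.
Qed.

(** * Reduced reflection factorizations and the absolute order *)

Section ReducedFactorizations.
Variables (n : nat) (m : 'I_n -> 'I_n -> option nat).
Hypothesis coxM : coxeter_matrix m.
Local Notation W := (WR m).
Local Notation T := (is_reflection m).
Implicit Types (a c : word 'I_n) (p q s t ts us : seq (word 'I_n)).

Let m_diag : forall i, m i i = Some 1.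
Proof. by case: coxM. Qed.

Lemma factorizationP a ts : factorization W T a ts <->
  {in ts, forall x, T x} /\ peq W (flatten ts) a.
Proof.
split=> -[Tts E]; split=> //.
  move=> x /(nthP [::])[i i_ts <-].
  case: (Tts i i_ts) => // /(is_reflection_inv m_diag).
  by rewrite inv_wordK.
by move=> i i_ts; left; apply/Tts/mem_nth.
Qed.

Lemma factorization_cat a c s t : factorization W T a s ->
  factorization W T c t -> factorization W T (a ++ c) (s ++ t).
Proof.
move=> /factorizationP[Ts Es] /factorizationP[Tt Et]; apply/factorizationP.
by split=> [x|]; rewrite ?mem_cat ?flatten_cat ?Es ?Et // => /orP[/Ts|/Tt].
Qed.

Lemma factorization_peq a c ts :
  peq W a c -> factorization W T a ts -> factorization W T c ts.
Proof. by move=> ac [Tts E]; split=> //; rewrite E. Qed.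

Lemma is_length_uniq a k l : is_length W T a k -> is_length W T a l -> k = l.
Proof.
move=> [[ts [<- Fts]] mink] [[us [<- Fus]] minl].
by apply/eqP; rewrite eqn_leq mink ?minl.
Qed.

Lemma reduced_size a ts us :
  reduced W T a ts -> reduced W T a us -> size ts = size us.
Proof. by move=> [_ l] [_ l']; apply: is_length_uniq l l'. Qed.

Lemma reduced_resize a ts us : reduced W T a ts ->
  factorization W T a us -> size us = size ts -> reduced W T a us.
Proof. by move=> [_ [_ mints]] Fus sz; split=> //; split; [exists us | rewrite sz]. Qed.

Lemma reduced_tuple_peq a ts us :
  reduced W T a ts -> tuple_peq W ts us -> reduced W T a us.
Proof.
move=> red ts_us; have [/factorizationP[Tts E] _] := red.
have [sz Eu] := ts_us; apply: (reduced_resize red) => //; apply/factorizationP.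
split; last by rewrite -ts_us.
move=> u /(nthP [::])[i]; rewrite -sz => i_ts <-.
exact: is_reflection_peq (Eu i i_ts) (Tts _ (mem_nth _ i_ts)).
Qed.

Lemma reduced_hurwitz a ts beta : braid_word (size ts) beta ->
  reduced W T a ts -> reduced W T a (hurwitz beta ts).
Proof.
move=> beta_ts red; have [/factorizationP[Tts E] _] := red.
apply: (reduced_resize red); last exact: size_hurwitz.
apply/factorizationP; split; last by rewrite flatten_hurwitz.
move: beta beta_ts.
apply: (hurwitz_ind (P := fun _ s => {in s, forall x, T x})) => //.
move=> beta b p x y q _ _ Ts z; rewrite !mem_cat.
have Tx : T x by apply: Ts; rewrite mem_cat !inE eqxx orbT.
have Ty : T y by apply: Ts; rewrite mem_cat !inE eqxx !orbT.
case/or3P=> [zp||zq]; [by apply: Ts; rewrite mem_cat zp | |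
  by apply: Ts; rewrite mem_cat !inE zq !orbT].
case: b => /=; rewrite !inE => /orP[]/eqP-> //; last exact: is_reflection_conj.
by have := is_reflection_conj (inv_word y) Tx; rewrite inv_wordK.
Qed.

(** A shorter factorization of the prefix, followed by [t], would shorten the factorization of
    [c]. *)
Lemma reduced_catl c s t : reduced W T c (s ++ t) -> reduced W T (flatten s) s.
Proof.
move=> [/factorizationP[Tst E] [_ minst]].
have Fs : factorization W T (flatten s) s.
  by apply/factorizationP; split=> // x xs; apply: Tst; rewrite mem_cat xs.
split=> //; split=> [|us Fus]; first by exists s.
rewrite -(leq_add2r (size t)) -!size_cat; apply: minst.
rewrite flatten_cat in E; apply: factorization_peq E _.
apply: factorization_cat Fus _; apply/factorizationP; split=> // x xt.
by apply: Tst; rewrite mem_cat xt orbT.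
Qed.

(** Moving [s] left across [q] conjugates [q] by the product of [s] and keeps both the total product
    and the number of factors. This brings an inner block to the front, or two distant entries side
    by side. *)
Lemma reduced_rotate c p q s t : reduced W T c (p ++ q ++ s ++ t) ->
  reduced W T c (p ++ s ++
    [seq inv_word (flatten s) ++ u ++ flatten s | u <- q] ++ t).
Proof.
move=> red; have [/factorizationP[Tts E] _] := red.
apply: (reduced_resize red); last first.
  by rewrite !size_cat size_map [in RHS](addnCA (size q)).
apply/factorizationP; split=> [x|]; last first.
  by rewrite -E !flatten_cat flatten_conj -!catA peq_mulVK.
rewrite !mem_cat => /or4P[xp|xs|/mapP[u uq ->]|xt].
- by apply: Tts; rewrite !mem_cat xp.
- by apply: Tts; rewrite !mem_cat xs !orbT.
- rewrite -{2}[flatten s]inv_wordK; apply: is_reflection_conj.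
  by apply: Tts; rewrite !mem_cat uq orbT.
- by apply: Tts; rewrite !mem_cat xt !orbT.
Qed.

Lemma reduced_infix c p s t :
  reduced W T c (p ++ s ++ t) -> reduced W T (flatten s) s.
Proof. by move=> /(@reduced_rotate _ [::])/= /reduced_catl. Qed.

Lemma le_gen_prefix c s t :
  reduced W T c (s ++ t) -> le_gen W T (flatten s) c.
Proof.
move=> red; have [_ lens] := reduced_catl red.
have [/factorizationP[Tst E] [_ minst]] := red.
exists (size s), (size t), (size (s ++ t)); split=> //; last by rewrite size_cat.
  have Ft : factorization W T (inv_word (flatten s) ++ c) t.
    apply/factorizationP; split; last by rewrite -E flatten_cat peq_VmulK.
    by move=> x xt; apply: Tst; rewrite mem_cat xt orbT.
  split=> [|us Fus]; first by exists t.
  rewrite -(leq_add2l (size s)) -!size_cat; apply: minst.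
  have [Fs _] := reduced_catl red.
  by apply: factorization_peq (factorization_cat Fs Fus); rewrite peq_mulVK.
by case: red.
Qed.

Lemma le_gen_infix c p s t :
  reduced W T c (p ++ s ++ t) -> le_gen W T (flatten s) c.
Proof. by move=> /(@reduced_rotate _ [::])/= /le_gen_prefix. Qed.

Lemma reduced_extend a c ts : le_gen W T a c -> reduced W T a ts ->
  exists us, reduced W T c (ts ++ us).
Proof.
move=> [k1 [k2 [k3 [len1 [[us [<- Fus]] _] len3 E]]]] [Fts len].
exists us; have F : factorization W T c (ts ++ us).
  by apply: factorization_peq (factorization_cat Fts Fus); rewrite peq_mulVK.
by split=> //; rewrite size_cat (is_length_uniq len len1) E.
Qed.

Lemma reduced_reflection x : T x -> reduced W T x [:: x].
Proof.
move=> Tx; have F : factorization W T x [:: x].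
  by apply/factorizationP; split=> [y|]; rewrite ?inE /= ?cats0 // => /eqP->.
split=> //; split=> [|[|//] [_ /= E]]; first by exists [:: x].
by case: (reflection_neq1 Tx (peq_sym E)).
Qed.

End ReducedFactorizations.

(** * The isomorphism *)

Lemma map_eq_split A B (f : A -> B) s p x y q : map f s = p ++ x :: y :: q ->
  exists p' x' y' q', s = p' ++ x' :: y' :: q' /\
    [/\ map f p' = p, f x' = x, f y' = y & map f q' = q].
Proof.
elim: p s => [|z p IH] [|a s] //=.
  by case: s => [|b s] //= [<- <- <-]; exists [::], a, b, s.
move=> [<- /IH[p' [x' [y' [q' [-> [<- <- <- <-]]]]]]].
by exists (a :: p'), x', y', q'.
Qed.

Section DualArtin.
Variables (n : nat) (m : 'I_n -> 'I_n -> option nat) (sigma : 'I_n -> 'I_n).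
Hypotheses (coxM : coxeter_matrix m) (bij_sigma : bijective sigma).
Local Notation W := (WR m).
Local Notation T := (is_reflection m).
Local Notation h := (coxeter_elt sigma).
Local Notation S := (simple_tuple sigma).
Local Notation interval := (in_interval m sigma).
Local Notation dual := (dual_gen m sigma).
Local Notation D := (dual_rel m sigma).

Definition dual_word (d : dual) : word 'I_n := proj1_sig d.

Lemma size_simple : size S = n.
Proof. by rewrite size_map size_enum_ord. Qed.

Lemma reduced_simple : reduced W T h S.
Proof.
have F : factorization W T h S.
  apply/(factorizationP coxM); split.
    by move=> x /mapP[i _ ->]; apply: is_reflection_gen.
  by rewrite /simple_tuple /gen flatten_map1.
split=> //; split=> [|ts]; first by exists S.
by rewrite size_simple; apply: coxeter_elt_length.
Qed.

Lemma size_reduced ts : reduced W T h ts -> size ts = n.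
Proof. by move=> red; rewrite (reduced_size red reduced_simple) size_simple. Qed.

Lemma interval_coxeter : interval h.
Proof.
have := reduced_simple; rewrite -[X in reduced _ _ _ X]cats0.
by move/(le_gen_prefix coxM); rewrite /simple_tuple /gen flatten_map1.
Qed.

Lemma interval_infix a p s t : interval a -> reduced W T a (p ++ s ++ t) ->
  interval (flatten s).
Proof.
move=> Ia /(reduced_extend coxM Ia)[us]; rewrite -!catA.
exact: le_gen_infix.
Qed.

Lemma entry_dual a ts x : interval a -> reduced W T a ts -> x \in ts ->
  T x /\ interval x.
Proof.
move=> Ia red x_ts; split.
  by have [/(factorizationP coxM)[Tts _] _] := red; apply: Tts.
case/splitPr: x_ts red => p q; rewrite -cat1s => /(interval_infix Ia).
by rewrite /= cats0.
Qed.

Lemma dual_word_exists a ts x : interval a -> reduced W T a ts -> x \in ts ->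
  exists d : dual, dual_word d = x.
Proof. by move=> Ia red x_ts; exists (exist _ x (entry_dual Ia red x_ts)). Qed.

Lemma dual_relation a (ds es : seq dual) : interval a ->
  reduced W T a (map dual_word ds) -> reduced W T a (map dual_word es) ->
  peq D [seq (d, false) | d <- ds] [seq (e, false) | e <- es].
Proof.
move=> Ia red_d red_e; apply: peq_relation; exists a, ds, es; split=> //; split=> //.
by have := reduced_size red_d red_e; rewrite !size_map.
Qed.

(** Dual generators are words with proofs, so one reflection has many of them; the dual relations of
    length one identify these. *)
Lemma dual_gen_peq (d e : dual) :
  peq W (dual_word d) (dual_word e) -> peq D (gen d) (gen e).
Proof.
move=> de; have [Td Id] := proj2_sig d; have red := reduced_reflection coxM Td.
apply: (dual_relation (ds := [:: d]) (es := [:: e]) Id red).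
by apply: (reduced_tuple_peq coxM red); apply/tuple_peq_cons.
Qed.

(** Each move is a dual relation of length two: adjacent entries form a reduced pair whose product,
    as an infix, lies in the interval. Moves in $W$ therefore carry over to moves in the dual
    group. *)
Lemma dual_hurwitz a (ds : seq dual) beta : interval a ->
  reduced W T a (map dual_word ds) -> braid_word (size ds) beta ->
  exists2 es : seq dual, map dual_word es = hurwitz beta (map dual_word ds) &
    tuple_peq D (map gen es) (hurwitz beta (map gen ds)).
Proof.
move=> Ia red; rewrite -(size_map dual_word) => beta_ds; move: beta beta_ds.
apply: (hurwitz_ind (P := fun beta s => exists2 es : seq dual,
  map dual_word es = s & tuple_peq D (map gen es) (hurwitz beta (map gen ds)))).
  by exists ds.
move=> beta b p x y q beta_ds E [es Ees es_ds].
have [ep [dx [dy [er [Es [Ep Ex Ey Eq]]]]]] := map_eq_split Ees.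
have red' := reduced_hurwitz coxM beta_ds red; rewrite E in red'.
have letter_ok : braid_word (size (p ++ x :: y :: q)) [:: ((size p).+1, b)].
  by rewrite /braid_word /= size_cat /= addnS ltnS addnS ltnS leq_addr.
have := reduced_hurwitz coxM letter_ok red'.
rewrite /= hurwitz_letter_cat => red2.
have pair_red := reduced_infix coxM (s := [:: x; y]) red'.
have pair_I := interval_infix (s := [:: x; y]) Ia red'.
have pair_red2 := reduced_infix coxM red2.
have flat2 : peq W (flatten (hurwitz_pair b x y)) (flatten [:: x; y]).
  by case: (b); rewrite /= !cats0 -?catA ?peq_mulVK ?peq_Vmul ?cats0.
have {}pair_red2 : reduced W T (flatten [:: x; y]) (hurwitz_pair b x y).
  apply: (reduced_resize pair_red); last by case: (b).
  by case: pair_red2 => F _; apply: factorization_peq flat2 F.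
(* The only new entry of the pair; a dual generator carrying exactly this word is needed. *)
pose z := if b then inv_word y ++ x ++ y else x ++ y ++ inv_word x.
have [dz Ez] : exists d : dual, dual_word d = z.
  apply: (dual_word_exists pair_I pair_red2).
  by rewrite /z; case: (b); rewrite !inE eqxx ?orbT.
pose new := if b then [:: dy; dz] else [:: dz; dx].
have new_words : map dual_word new = hurwitz_pair b x y.
  by rewrite /new; move: Ez; rewrite /z; case: (b) => /= ->; rewrite ?Ex ?Ey.
exists (ep ++ new ++ er); first by rewrite !map_cat new_words Ep Eq.
have rel : peq D [seq (d, false) | d <- new] (gen dx ++ gen dy).
  apply: (dual_relation (es := [:: dx; dy]) pair_I); first by rewrite new_words.
  by rewrite /= Ex Ey.
transitivity (hurwitz [:: ((size p).+1, b)] (map gen es)); last first.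
  by apply: hurwitz_peq => //; rewrite size_map -(size_map dual_word) Ees.
have szp : size p = size (map gen ep) by rewrite -Ep !size_map.
rewrite Es !map_cat szp /= hurwitz_letter_cat.
apply/tuple_peq_cat => //; split=> //; apply/tuple_peq_cat.
  by rewrite /new; case: (b).
(* Either way [rel] is solved for [gen dz], exhibiting it as the required conjugate in the dual
   group. *)
split=> //; move: rel; rewrite /new; case: (b) => rel.
  apply/tuple_peq_cons; split=> //; apply/tuple_peq_cons; split=> //.
  rewrite -[[seq _ | _ <- _]]/(gen dy ++ gen dz) in rel.
  by transitivity (inv_word (gen dy) ++ gen dx ++ gen dy); rewrite // -rel peq_VmulK.
apply/tuple_peq_cons; split; last by apply/tuple_peq_cons.
rewrite -[[seq _ | _ <- _]]/(gen dz ++ gen dx) in rel.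
transitivity (gen dx ++ gen dy ++ inv_word (gen dx)); last by [].
by rewrite catA -rel -catA peq_mulV cats0.
Qed.

(** * From the Artin group to the dual Artin group *)

Lemma mem_simple i : gen i \in S.
Proof.
have [tau _ tauK] := bij_sigma.
by apply/mapP; exists (tau i); rewrite ?mem_enum ?tauK.
Qed.

Definition simple_dual (i : 'I_n) : dual :=
  exist _ (gen i) (entry_dual interval_coxeter reduced_simple (mem_simple i)).

(** Here [a] and [b] are positions in $s_1\cdots s_n$. Sliding the later generator left conjugates
    only those in between, so the pair becomes an infix of a reduced factorization of $h$. *)
Lemma simple_pair (a b : 'I_n) : a < b ->
  let s := [:: gen (sigma a); gen (sigma b)] in
  interval (flatten s) /\ reduced W T (flatten s) s.
Proof.
move=> ab s; have [p [q [r E]]] : exists p q r, enum 'I_n = p ++ a :: q ++ b :: r.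
  have bn : b < size (enum 'I_n) by rewrite size_enum_ord.
  have a_take : a \in take b (enum 'I_n).
    rewrite -{1}(nth_ord_enum a a) -(nth_take a ab) mem_nth //.
    by rewrite size_takel // ltnW.
  have := cat_take_drop b (enum 'I_n); rewrite (drop_nth b bn) nth_ord_enum.
  by case/splitPr: a_take => p q <-; exists p, q, (drop b.+1 (enum 'I_n));
     rewrite -catA.
pose g k := gen (sigma k).
have red : reduced W T h ((map g p ++ [:: g a]) ++ map g q ++ [:: g b] ++ map g r).
  have := reduced_simple.
  by rewrite /simple_tuple E map_cat /= map_cat -catA.
have {}red := reduced_rotate coxM red; rewrite -catA in red.
split; first exact: (interval_infix (s := s) interval_coxeter red).
exact: (reduced_infix coxM (s := s) red).
Qed.

(** By [hurwitz_power_braid], the relation in $W$ says that $\sigma_1^k$ puts the second generator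
    back in second place. [dual_hurwitz] carries this to dual generators, where the same equivalence
    yields the braid relation. *)
Lemma simple_dual_braid (a b : 'I_n) k : a < b -> m (sigma a) (sigma b) = Some k ->
  let A := gen (simple_dual (sigma a)) in let B := gen (simple_dual (sigma b)) in
  peq D (alt_prod A B k) (alt_prod B A k).
Proof.
move=> ab mab A B; have [Ipair red] := simple_pair ab.
have k0 : 0 < k.
  have [_ _ m2] := coxM; have sab : sigma a != sigma b.
    by rewrite (bij_eq bij_sigma) neq_ltn ab.
  by case: (m2 _ _ sab); rewrite mab // => -[l [[->]]]; apply: ltnW.
apply/hurwitz_power_braid => //.
pose ds := [:: simple_dual (sigma a); simple_dual (sigma b)].
have beta_ok : braid_word (size ds) (nseq k (1, false)).
  by rewrite /braid_word all_nseq orbT.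
have [es Ees es_ds] := dual_hurwitz (ds := ds) Ipair red beta_ok.
have := coxeter_braid coxM mab; rewrite -!alt_prod_gen.
move/(hurwitz_power_braid _ _ _ k0); rewrite -[[:: _; _]]/(map dual_word ds) -Ees.
have szes : size es = 2 by rewrite -(size_map dual_word) Ees size_hurwitz.
have [_ /(_ 1)] := es_ds; rewrite size_map szes => /(_ isT) <-.
case: es szes {Ees es_ds} => [|d [|e []]] //= _ Ee.
exact: dual_gen_peq.
Qed.

Lemma artin_to_dual : induces_hom (AR m) D (fun i => gen (simple_dual i)).
Proof.
move=> u v [i [j [k [ij [mij [-> ->]]]]]]; rewrite !extw_alt.
have [tau sigmaK tauK] := bij_sigma.
have [mC _ _] := coxM.
rewrite -(tauK i) -(tauK j) in mij *.
(* Artin relations are ordered by index but pairs by position in $h$; where the orders disagree, the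
   relation is reversed. *)
have [lt|lt|E] := ltngtP (tau i) (tau j).
- exact: simple_dual_braid.
- by symmetry; apply: simple_dual_braid => //; rewrite mC.
- by move: ij; rewrite -(tauK i) -(tauK j) (val_inj E) ltnn.
Qed.

Lemma extw_simple : map (extw (fun i => gen (simple_dual i))) S =
  map gen [seq simple_dual (sigma i) | i <- enum 'I_n].
Proof. by rewrite -!map_comp; apply: eq_map => i /=; rewrite extw_gen. Qed.

(** This evaluates the composite of the two maps on dual generators: the homomorphism commutes with
    braids, and [dual_hurwitz] follows the braid inside the dual group. *)
Lemma extw_hurwitz_simple beta i (d : dual) : braid_word n beta -> i < n ->
  peq W (nth [::] (hurwitz beta S) i) (dual_word d) ->
  peq D (extw (fun i => gen (simple_dual i)) (nth [::] (hurwitz beta S) i)) (gen d).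
Proof.
move=> beta_n i_n Ed.
pose ds := [seq simple_dual (sigma i) | i <- enum 'I_n].
have words_ds : map dual_word ds = S by rewrite -map_comp.
have [||es Ees es_ds] := dual_hurwitz (ds := ds) (beta := beta) interval_coxeter.
- by rewrite words_ds; apply: reduced_simple.
- by rewrite size_map size_enum_ord.
have szS : size (hurwitz beta S) = n by rewrite size_hurwitz size_simple.
have szes : size es = n by rewrite -(size_map dual_word) Ees words_ds.
rewrite -(nth_map _ [::]) ?szS // map_extw_hurwitz extw_simple.
have [_ /(_ i)] := es_ds; rewrite size_map szes => /(_ i_n) <-.
rewrite (nth_map d) ?szes //; apply: dual_gen_peq; rewrite -Ed -words_ds -Ees.
by rewrite (nth_map d) ?szes.
Qed.

(** * From the dual Artin group to the Artin group *)

Hypotheses (wstab : well_stabilized m sigma) (pant : pan_transitive m sigma).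

Lemma hurwitz_simple_reduced beta : braid_word n beta -> reduced W T h (hurwitz beta S).
Proof.
move=> beta_n; apply: (reduced_hurwitz coxM); first by rewrite size_simple.
exact: reduced_simple.
Qed.

Lemma hurwitz_reach ts : reduced W T h ts ->
  exists2 beta, braid_word n beta & tuple_peq W (hurwitz beta S) ts.
Proof.
move=> red; have [_ len] := reduced_simple; rewrite size_simple in len.
by have [beta [? ?]] := pant interval_coxeter len reduced_simple red; exists beta.
Qed.

(** Equality in $W$ puts $\gamma^{-1}\beta$ in $H=\bar H$; applying $\gamma$ then gives equality in
    the Artin group. *)
Lemma hurwitz_simple_lift beta gamma : braid_word n beta -> braid_word n gamma ->
  tuple_peq W (hurwitz beta S) (hurwitz gamma S) ->
  tuple_peq (AR m) (hurwitz beta S) (hurwitz gamma S).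
Proof.
move=> beta_n gamma_n E; have gammaV := braid_word_inv gamma_n.
have sz delta : size (hurwitz delta S) = n by rewrite size_hurwitz size_simple.
have /(wstab (braid_word_cat gammaV beta_n)) :
    tuple_peq W (hurwitz (inv_word gamma ++ beta) S) S.
  rewrite hurwitz_cat; transitivity (hurwitz (inv_word gamma) (hurwitz gamma S)).
    by apply: hurwitz_peq; rewrite ?sz.
  by apply: hurwitzK; rewrite size_simple.
move/(hurwitz_peq (beta := gamma)); rewrite sz => /(_ gamma_n) <-.
rewrite hurwitz_cat -{1}[gamma]inv_wordK; symmetry.
by apply: hurwitzK; rewrite sz.
Qed.

(* Two Hurwitz conjugates of the simple tuple with the same head in W differ by
   a braid on the tail, which does not change the head in the Artin group. *)
Lemma head_lift beta gamma : braid_word n beta -> braid_word n gamma -> 0 < n ->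
  peq W (nth [::] (hurwitz beta S) 0) (nth [::] (hurwitz gamma S) 0) ->
  peq (AR m) (nth [::] (hurwitz beta S) 0) (nth [::] (hurwitz gamma S) 0).
Proof.
move=> beta_n gamma_n n0 E.
have redb := hurwitz_simple_reduced beta_n.
have redg := hurwitz_simple_reduced gamma_n.
have lift delta := @hurwitz_simple_lift delta gamma.
case Eb : (hurwitz beta S) redb E => [|x s] redb E.
  by have := size_reduced redb; rewrite /= => n_eq; rewrite -n_eq in n0.
case Eg : (hurwitz gamma S) redg E lift => [|y t] redg E lift.
  by have := size_reduced redg; rewrite /= => n_eq; rewrite -n_eq in n0.
rewrite /= in E *.
have redt : reduced W T (flatten t) t.
  by apply: (reduced_infix coxM (p := [:: y]) (t := [::])); rewrite cats0; apply: redg.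
have It : interval (flatten t).
  apply: (interval_infix (p := [:: y]) (t := [::]) interval_coxeter).
  by rewrite cats0; apply: redg.
have szs : (size s).+1 = n := size_reduced redb.
have szt : (size t).+1 = n := size_reduced redg.
(* The heads agree in $W$, so cancelling them makes both tails factor the same element, and
   pan-transitivity joins them. *)
have reds : reduced W T (flatten t) s.
  have [Fs _] : reduced W T (flatten s) s.
    by apply: (reduced_infix coxM (p := [:: x]) (t := [::]));
       rewrite cats0; apply: redb.
  apply: (reduced_resize redt); last by apply: succn_inj; rewrite szs szt.
  apply: factorization_peq Fs; apply: (@peq_catI _ _ x).
  have [/(factorizationP coxM)[_ /= ->] _] := redb.
  by rewrite E; have [/(factorizationP coxM)[_ /= ->] _] := redg.
have [delta [delta_s st]] := pant It (proj2 reds) reds redt.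
(* Shifting indices by one makes the braid act on the tail alone and leaves the head as the same
   word. *)
pose delta' := [seq (l.1.+1, l.2) | l <- delta].
have Ed : hurwitz (delta' ++ beta) S = x :: hurwitz delta s.
  by rewrite hurwitz_cat Eb hurwitz_cons.
have delta'_n : braid_word n delta'.
  by rewrite /braid_word all_map -szs; apply: sub_all delta_s => l /andP[].
have := lift (delta' ++ beta) (braid_word_cat delta'_n beta_n) gamma_n.
rewrite Ed => H.
by have /tuple_peq_cons[] : tuple_peq (AR m) (x :: hurwitz delta s) (y :: t);
  first by apply: H; apply/tuple_peq_cons.
Qed.

(** [to_front] brings an entry to the head as the same word, hence in $W$ and in the Artin group
    alike. *)
Lemma entry_lift beta gamma i j : braid_word n beta -> braid_word n gamma ->
  i < n -> j < n ->
  peq W (nth [::] (hurwitz beta S) i) (nth [::] (hurwitz gamma S) j) ->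
  peq (AR m) (nth [::] (hurwitz beta S) i) (nth [::] (hurwitz gamma S) j).
Proof.
move=> beta_n gamma_n i_n j_n.
have front delta k : k < n ->
    nth [::] (hurwitz delta S) k = nth [::] (hurwitz (to_front k ++ delta) S) 0.
  by move=> k_n; rewrite hurwitz_cat nth_to_front // size_hurwitz size_simple.
rewrite (front beta i) // (front gamma j) // => E.
apply: head_lift E; last exact: leq_ltn_trans i_n.
  by apply: braid_word_cat => //; apply: to_front_braid.
by apply: braid_word_cat => //; apply: to_front_braid.
Qed.

Lemma lift_exists (d : dual) : exists beta,
  [/\ braid_word n beta, 0 < n & peq W (nth [::] (hurwitz beta S) 0) (dual_word d)].
Proof.
have [Td Id] := proj2_sig d.
have [us red] := reduced_extend coxM Id (reduced_reflection coxM Td).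
have [beta beta_n [sz E]] := hurwitz_reach red.
have n0 : 0 < n by rewrite -(size_reduced red).
by exists beta; split=> //; apply: E; rewrite size_hurwitz size_simple.
Qed.

(** An arbitrary choice; by [lift_entry] the resulting element of the Artin group does not depend on
    it. *)
Definition lift_braid (d : dual) : seq (nat * bool) :=
  proj1_sig (constructive_indefinite_description _ (lift_exists d)).

Definition lift (d : dual) : word 'I_n := nth [::] (hurwitz (lift_braid d) S) 0.

Lemma lift_braidP d :
  [/\ braid_word n (lift_braid d), 0 < n & peq W (lift d) (dual_word d)].
Proof. exact: proj2_sig (constructive_indefinite_description _ (lift_exists d)). Qed.

Lemma lift_entry d beta i : braid_word n beta -> i < n ->
  peq W (nth [::] (hurwitz beta S) i) (dual_word d) ->
  peq (AR m) (lift d) (nth [::] (hurwitz beta S) i).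
Proof.
have [lift_n n0 Ed] := lift_braidP d.
by move=> beta_n i_n E; apply: entry_lift; rewrite // E.
Qed.

Lemma lift_tuple beta (ds : seq dual) us : braid_word n beta ->
  tuple_peq W (hurwitz beta S) (map dual_word ds ++ us) ->
  tuple_peq (AR m) (map lift ds) (take (size ds) (hurwitz beta S)).
Proof.
move=> beta_n [sz E].
move: (sz); rewrite size_hurwitz size_simple size_cat size_map => szn.
have le_n : size ds <= n := leq_trans (leq_addr _ _) (eq_leq (esym szn)).
split=> [|i]; rewrite size_map.
  by rewrite size_takel // size_hurwitz size_simple.
move=> i_ds; have i_n := leq_trans i_ds le_n.
have d0 : dual by case: (ds) i_ds => // d.
rewrite nth_take // (nth_map d0) //; apply: lift_entry => //.
rewrite E ?size_hurwitz ?size_simple //.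
by rewrite nth_cat size_map i_ds (nth_map d0).
Qed.

(** Both factorizations of [a] are completed by the same [us]. The braid joining them acts on the
    first [size ds] entries only, so the two lifted tuples are initial segments differing by
    [gamma], which preserves their product. *)
Lemma dual_to_artin : induces_hom D (AR m) lift.
Proof.
move=> u v [a [ds [es [Ia [redd rede _ -> ->]]]]]; rewrite !extw_positive.
have [us red] := reduced_extend coxM Ia redd.
have [beta beta_n E] := hurwitz_reach red.
have szde : size ds = size es.
  by have := reduced_size redd rede; rewrite !size_map.
have [gamma [gamma_d de]] := pant Ia (proj2 redd) redd rede.
rewrite size_map in gamma_d.
have := size_reduced red; rewrite size_cat size_map => szn.
have le_n : size ds <= n := leq_trans (leq_addr _ _) (eq_leq szn).
have gamma_n := braid_word_widen le_n gamma_d.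
have szb : size (hurwitz beta S) = n by rewrite size_hurwitz size_simple.
have gamma_take : braid_word (size (take (size ds) (hurwitz beta S))) gamma.
  by rewrite size_takel ?szb.
have E' : tuple_peq W (hurwitz (gamma ++ beta) S) (map dual_word es ++ us).
  rewrite hurwitz_cat; transitivity (hurwitz gamma (map dual_word ds ++ us)).
    by apply: hurwitz_peq; rewrite ?szb.
  rewrite hurwitz_catl ?size_map //; apply/tuple_peq_cat => //.
  by case: de.
rewrite (lift_tuple beta_n E) (lift_tuple (braid_word_cat gamma_n beta_n) E') -szde.
rewrite hurwitz_cat -[in X in peq _ _ X](cat_take_drop (size ds) (hurwitz beta S)).
rewrite hurwitz_catl // take_size_cat ?flatten_hurwitz //.
by rewrite size_hurwitz size_takel ?szb.
Qed.

Lemma lift_simple_dual i : peq (AR m) (lift (simple_dual i)) (gen i).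
Proof.
have [tau _ tauK] := bij_sigma.
have Ei : gen i = nth [::] (hurwitz [::] S) (tau i).
  by rewrite /= (nth_map i) ?size_enum_ord // nth_ord_enum tauK.
by rewrite Ei; apply: lift_entry; rewrite -?Ei.
Qed.

End DualArtin.

Theorem theorem3p11 (n : nat) (m : 'I_n -> 'I_n -> option nat)
  (sigma : 'I_n -> 'I_n) :
  coxeter_matrix m -> bijective sigma ->
  well_stabilized m sigma -> pan_transitive m sigma ->
  pres_iso (AR m) (dual_rel m sigma).
Proof.
move=> coxM bij_sigma wstab pant.
exists (fun i => gen (simple_dual coxM bij_sigma i)), (lift coxM bij_sigma pant).
split.
- exact: artin_to_dual.
- exact: dual_to_artin.
- by move=> i; rewrite extw_gen; apply: lift_simple_dual.
- move=> d; have [beta_n n0 E] := lift_braidP coxM bij_sigma pant d.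
  exact: extw_hurwitz_simple.
Qed.
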